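(* Let $P$ be a cycle of a convergent pattern $\pi$ such that the $P$-linear map $f$ has over-rotation interval $I_f=[\rho(P),\frac12]$ (i.e. $r_\pi=\rho(\pi)$), and suppose the over-rotation pair of $P$ is coprime. Then $\pi$ is an over-twist pattern.
   Context: A cyclic pattern is the equivalence class of a cyclic permutation realized by a periodic orbit $P$ on the line; the $P$-linear map is the map on $[\min P,\max P]$ agreeing with the cycle on $P$ and affine between consecutive points of $P$. A pattern $A$ forces $B$ if every continuous interval map with a cycle of pattern $A$ has a cycle of pattern $B$. Over-rotation pair: for a cycle $P$ of period $q\ge 2$ of $f$, $2p$ is the number of $x\in P$ with $f(x)-x$ and $f^2(x)-f(x)$ of different signs; $orp(P)=(p,q)$, $\rho(P)=p/q$. The over-rotation interval $I_f$ of a map is the closure of the set of over-rotation numbers of its non-fixed periodic orbits, of the form $[r_f,\frac12]$; for a pattern $\pi$ with representative $P$, $r_\pi$ is $r_{f}$ for the $P$-linear map $f$. A cycle is convergent if there are no points $x<y$ in it with $f(x)<x$ and $f(y)>y$. An over-twist pattern is a pattern minimal with respect to forcing among patterns of the same over-rotation number. *)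

(* Defs.v *)
From Stdlib Require Import Reals Lra Lia Arith List ZArith.
Import ListNotations.
Open Scope R_scope.

(* A cyclic pattern of period n is a cyclic permutation pi of {0,...,n-1}:
   the i-th point (in the spatial order) of a representative cycle is mapped
   to the (pi i)-th point. *)
Definition is_cyclic_pattern (n : nat) (pi : nat -> nat) : Prop :=
  (forall i, (i < n)%nat -> (pi i < n)%nat) /\
  (forall i j, (i < n)%nat -> (j < n)%nat -> pi i = pi j -> i = j) /\
  (forall i, (i < n)%nat -> exists k, Nat.iter k pi 0%nat = i).

Definition same_pattern (n : nat) (pi : nat -> nat) (m : nat) (th : nat -> nat) : Prop :=
  n = m /\ forall i, (i < n)%nat -> pi i = th i.

Definition has_cycle_of_pattern (f : R -> R) (a b : R) (n : nat) (pi : nat -> nat) : Prop :=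
  exists x : nat -> R,
    (forall i j, (i < j)%nat -> (j < n)%nat -> x i < x j) /\
    (forall i, (i < n)%nat -> a <= x i <= b) /\
    (forall i, (i < n)%nat -> f (x i) = x (pi i)).

(* Continuous interval maps f : [a,b] -> [a,b]; represented as continuous maps
   of R leaving [a,b] invariant (every continuous map of [a,b] extends). *)
Definition interval_map (f : R -> R) (a b : R) : Prop :=
  a <= b /\ continuity f /\ (forall t, a <= t <= b -> a <= f t <= b).

Definition forces (n : nat) (pi : nat -> nat) (m : nat) (th : nat -> nat) : Prop :=
  forall (f : R -> R) (a b : R), interval_map f a b ->
    has_cycle_of_pattern f a b n pi -> has_cycle_of_pattern f a b m th.

Definition pat_turn (pi : nat -> nat) (i : nat) : nat :=
  if orb (andb (pi i <? i)%nat (pi i <? pi (pi i))%nat) (andb (i <? pi i)%nat (pi (pi i) <? pi i)%nat)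
  then 1%nat else 0%nat.

(* = 2p *)
Definition pat_turns (n : nat) (pi : nat -> nat) : nat :=
  fold_right Nat.add 0%nat (map (pat_turn pi) (seq 0 n)).

Definition orp (n : nat) (pi : nat -> nat) : nat * nat :=
  (Nat.div (pat_turns n pi) 2, n).

Definition pat_rho (n : nat) (pi : nat -> nat) : R :=
  INR (pat_turns n pi) / (2 * INR n).

Definition convergent (n : nat) (pi : nat -> nat) : Prop :=
  ~ (exists i j, (i < j)%nat /\ (j < n)%nat /\ (pi i < i)%nat /\ (j < pi j)%nat).

Definition over_twist (n : nat) (pi : nat -> nat) : Prop :=
  forall (m : nat) (th : nat -> nat),
    (2 <= m)%nat -> is_cyclic_pattern m th ->
    pat_rho m th = pat_rho n pi ->
    forces n pi m th -> same_pattern n pi m th.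

(** * The P-linear map, for the representative P = {0,1,...,n-1} *)
Definition clamp (lo hi t : R) : R := Rmax lo (Rmin hi t).

Definition plin (n : nat) (pi : nat -> nat) (t : R) : R :=
  let s := clamp 0 (INR n - 1) t in
  let i := Z.to_nat (Int_part s) in
  INR (pi i) + (s - INR i) * (INR (pi (S i)) - INR (pi i)).

Definition turn (f : R -> R) (y : R) : nat :=
  if Rlt_dec (f y) y then (if Rlt_dec (f y) (f (f y)) then 1%nat else 0%nat)
  else if Rlt_dec y (f y) then (if Rlt_dec (f (f y)) (f y) then 1%nat else 0%nat)
  else 0%nat.

Definition orbit_turns (f : R -> R) (x : R) (m : nat) : nat :=
  fold_right Nat.add 0%nat (map (fun k => turn f (Nat.iter k f x)) (seq 0 m)).

Definition least_period (f : R -> R) (x : R) (m : nat) : Prop :=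
  (1 <= m)%nat /\ Nat.iter m f x = x /\
  (forall k, (1 <= k)%nat -> (k < m)%nat -> Nat.iter k f x <> x).

Definition over_rotation_numbers (f : R -> R) (a b : R) (r : R) : Prop :=
  exists x m, a <= x <= b /\ (2 <= m)%nat /\ least_period f x m /\
    r = INR (orbit_turns f x m) / (2 * INR m).

Definition is_glb (E : R -> Prop) (r : R) : Prop :=
  (forall y, E y -> r <= y) /\ (forall e, 0 < e -> exists y, E y /\ y < r + e).

(* r_f: the left endpoint of the over-rotation interval I_f = [r_f, 1/2]
   (the closure of the set of over-rotation numbers); since the closure has the
   same infimum, r_f is the glb of the set. *)
Definition left_endpoint_over_rotation_interval (f : R -> R) (a b : R) (r : R) : Prop :=
  is_glb (over_rotation_numbers f a b) r.

Definition r_pattern (n : nat) (pi : nat -> nat) (r : R) : Prop :=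
  left_endpoint_over_rotation_interval (plin n pi) 0 (INR n - 1) r.

(* Main.v *)
Require Import Defs.
From Stdlib Require Import Reals Arith Lra Lia List ZArith Permutation.
Open Scope R_scope.

(* Let [f] be the P-linear map, [a] its fixed point, [T = 2p]; the turns of an orbit are its crossings of [a].
   If [y] lies between [a] and its iterate [x = f^k y] on the same side of [a], then [f] has a
   periodic orbit of period dividing [k] with the itinerary of [y, ..., x], so minimality of [rho(P)]
   bounds from below the number of crossings on the way from [y] to [x].  Hence the potential
   [M] on P with [M (f x) = M x + n * turn x - T] grows away from [a], strictly because [p] and [n]
   are coprime.  Let Q be a cycle of [f] with [rho(Q) = rho(P)], and send each of its points [z] to the first
   point [g z] of P met when moving from [z] away from [a].  Then
   [M (g (f z)) <= M (g z) + n * turn z - T]; the sum over Q makes these equalities, and strict monotonicity of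
   [M] turns them into [g (f z) = f (g z)].  Finally [f] preserves the distance order inside a
   fibre of [g], which makes [g] injective, so that Q has the pattern of P. *)

(** * Sums along a cycle *)

Definition nsum (k : nat) (g : nat -> nat) : nat := list_sum (map g (seq 0 k)).

Lemma nsum_S (k : nat) (g : nat -> nat) : nsum (S k) g = (nsum k g + g k)%nat.
Proof.
  unfold nsum. rewrite seq_S, map_app, list_sum_app. simpl. lia.
Qed.

Lemma nsum_add (k l : nat) (g : nat -> nat) :
  nsum (k + l) g = (nsum k g + nsum l (fun j => g (k + j)))%nat.
Proof.
  induction l as [|l IH].
  - rewrite Nat.add_0_r. unfold nsum at 3. simpl. lia.
  - rewrite Nat.add_succ_r, !nsum_S, IH. lia.
Qed.

Lemma nsum_ext (k : nat) (g h : nat -> nat) :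
  (forall j, (j < k)%nat -> g j = h j) -> nsum k g = nsum k h.
Proof.
  induction k as [|k IH]; intros H; [reflexivity|].
  rewrite !nsum_S, IH by (intros; apply H; lia). rewrite H by lia. reflexivity.
Qed.

Lemma nsum_le_length (k : nat) (g : nat -> nat) :
  (forall j, (j < k)%nat -> (g j <= 1)%nat) -> (nsum k g <= k)%nat.
Proof.
  induction k as [|k IH]; intros H; [unfold nsum; simpl; lia|].
  rewrite nsum_S. specialize (IH (fun j h => H j (Nat.lt_lt_succ_r _ _ h))).
  specialize (H k (Nat.lt_succ_diag_r k)). lia.
Qed.

Lemma nsum_lt_length (k : nat) (g : nat -> nat) :
  (forall j, (j < k)%nat -> (g j <= 1)%nat) -> (nsum k g < k)%nat ->
  exists j, (j < k)%nat /\ g j = 0%nat.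
Proof.
  induction k as [|k IH]; intros H Hlt; [lia|].
  rewrite nsum_S in Hlt.
  destruct (Nat.eq_dec (g k) 0) as [E|E]; [exists k; split; [lia|exact E]|].
  destruct IH as [j [Hj E']].
  - intros j Hj. apply H. lia.
  - lia.
  - exists j. split; [lia|exact E'].
Qed.

(** A surjection of a finite set onto itself permutes it, so both sums have the same terms in a
    different order. *)
Lemma nsum_reindex (k : nat) (e g : nat -> nat) :
  (forall j, (j < k)%nat -> (e j < k)%nat) ->
  (forall i, (i < k)%nat -> exists j, (j < k)%nat /\ e j = i) ->
  nsum k (fun j => g (e j)) = nsum k g.
Proof.
  intros Hlt Hsurj. unfold nsum.
  rewrite <- (map_map e g).
  apply Permutation_list_sum, Permutation_map, Permutation_sym.
  apply NoDup_Permutation_bis.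
  - apply seq_NoDup.
  - rewrite length_map. lia.
  - intros i Hi. apply in_seq in Hi. apply in_map_iff.
    destruct (Hsurj i) as [j [Hj E]]; [lia|].
    exists j. split; [exact E|]. apply in_seq. lia.
Qed.

(** * Iterates of a cyclic permutation *)

Lemma iter_pattern_lt (n : nat) (pi : nat -> nat) (k i : nat) :
  is_cyclic_pattern n pi -> (i < n)%nat -> (Nat.iter k pi i < n)%nat.
Proof.
  intros [Hlt _] Hi. induction k as [|k IH]; simpl; auto.
Qed.

Lemma iter_pattern_inj (n : nat) (pi : nat -> nat) (k i j : nat) :
  is_cyclic_pattern n pi -> (i < n)%nat -> (j < n)%nat ->
  Nat.iter k pi i = Nat.iter k pi j -> i = j.
Proof.
  intros Hc Hi Hj. induction k as [|k IH]; simpl; intros E; [exact E|].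
  apply IH. destruct Hc as [H1 [H2 H3]].
  apply H2; auto; apply iter_pattern_lt; repeat split; auto.
Qed.

Lemma iter_mul_period {A : Type} (f : A -> A) (z : A) (d r : nat) :
  Nat.iter d f z = z -> Nat.iter (d * r) f z = z.
Proof.
  intros E. induction r as [|r IH].
  - rewrite Nat.mul_0_r. reflexivity.
  - rewrite Nat.mul_succ_r, Nat.iter_add, E. exact IH.
Qed.

Lemma iter_mod {A : Type} (f : A -> A) (z : A) (d k : nat) :
  Nat.iter d f z = z -> Nat.iter k f z = Nat.iter (k mod d) f z.
Proof.
  intros E. transitivity (Nat.iter (k mod d + d * (k / d)) f z).
  { f_equal. assert (H := Nat.div_mod_eq k d). lia. }
  rewrite Nat.iter_add, iter_mul_period by exact E. reflexivity.
Qed.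

(** Exponents may be reduced modulo any return time [d], so the first [d] iterates of 0 already
    exhaust the cycle; the pigeonhole principle does the rest. *)
Lemma cyclic_return_ge (n : nat) (pi : nat -> nat) (d : nat) :
  is_cyclic_pattern n pi -> (1 <= d)%nat -> Nat.iter d pi 0%nat = 0%nat ->
  (n <= d)%nat /\ forall i, (i < n)%nat -> exists k, (k < d)%nat /\ Nat.iter k pi 0%nat = i.
Proof.
  intros [_ [_ H3]] Hd E.
  assert (Hs : forall i, (i < n)%nat -> exists k, (k < d)%nat /\ Nat.iter k pi 0%nat = i).
  { intros i Hi. destruct (H3 i Hi) as [k Hk].
    exists (k mod d)%nat. split; [apply Nat.mod_upper_bound; lia|].
    rewrite <- Hk. symmetry. apply iter_mod, E. }
  split; [|exact Hs].
  assert (L : (length (seq 0 n) <= length (map (fun k => Nat.iter k pi 0%nat) (seq 0 d)))%nat).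
  { apply NoDup_incl_length; [apply seq_NoDup|].
    intros i Hi. apply in_seq in Hi. apply in_map_iff.
    destruct (Hs i) as [k [Hk Ek]]; [lia|]. exists k. split; [exact Ek|].
    apply in_seq. lia. }
  rewrite length_map, !length_seq in L. exact L.
Qed.

(** [is_cyclic_pattern] puts no bound on the exponents that reach the points. Two of the first
    [n + 1] iterates of 0 coincide, which by injectivity gives a return time of at most [n]; by
    [cyclic_return_ge] it is not smaller. *)
Lemma iter_period (n : nat) (pi : nat -> nat) :
  (1 <= n)%nat -> is_cyclic_pattern n pi -> Nat.iter n pi 0%nat = 0%nat.
Proof.
  intros Hn Hc.
  set (l := map (fun k => Nat.iter k pi 0%nat) (seq 0 (S n))).
  assert (Hnd : ~ NoDup l).
  { intros Hd. assert (L : (length l <= length (seq 0 n))%nat).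
    { apply NoDup_incl_length; [exact Hd|]. intros i Hi.
      apply in_map_iff in Hi. destruct Hi as [k [<- _]].
      apply in_seq. split; [lia|]. apply iter_pattern_lt; [exact Hc|lia]. }
    unfold l in L. rewrite length_map, !length_seq in L. lia. }
  assert (Hex : exists d, (1 <= d <= n)%nat /\ Nat.iter d pi 0%nat = 0%nat).
  { destruct (existsb (fun d => Nat.iter d pi 0 =? 0)%nat (seq 1 n)) eqn:Eb.
    - apply existsb_exists in Eb. destruct Eb as [d [Hd E]].
      apply in_seq in Hd. apply Nat.eqb_eq in E. exists d. split; [lia|exact E].
    - exfalso. apply Hnd. unfold l. apply NoDup_map_NoDup_ForallPairs; [|apply seq_NoDup].
      assert (Hno : forall d, (1 <= d <= n)%nat -> Nat.iter d pi 0%nat <> 0%nat).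
      { intros d Hd E. assert (Et : existsb (fun d => Nat.iter d pi 0 =? 0)%nat (seq 1 n) = true).
        { apply existsb_exists. exists d. split; [apply in_seq; lia|]. apply Nat.eqb_eq, E. }
        congruence. }
      assert (Hlt : forall i j, (i < j <= n)%nat -> Nat.iter i pi 0%nat <> Nat.iter j pi 0%nat).
      { intros i j Hij E. apply (Hno (j - i)%nat); [lia|].
        symmetry. apply (iter_pattern_inj n pi i); [exact Hc|lia|apply iter_pattern_lt; [exact Hc|lia]|].
        rewrite E, <- Nat.iter_add. f_equal. lia. }
      intros i j Hi Hj E. apply in_seq in Hi, Hj.
      destruct (Nat.lt_trichotomy i j) as [H|[H|H]]; [|exact H|].
      + exfalso. apply (Hlt i j); [lia|exact E].
      + exfalso. apply (Hlt j i); [lia|symmetry; exact E]. }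
  destruct Hex as [d [Hd E]].
  destruct (cyclic_return_ge n pi d Hc) as [Hle _]; [lia|exact E|].
  replace n with d by lia. exact E.
Qed.

Lemma orbit_surj (n : nat) (pi : nat -> nat) (i : nat) :
  is_cyclic_pattern n pi -> (i < n)%nat ->
  exists k, (k < n)%nat /\ Nat.iter k pi 0%nat = i.
Proof.
  intros Hc Hi. apply (cyclic_return_ge n pi n Hc); [lia| |exact Hi].
  apply iter_period; [lia|exact Hc].
Qed.

Lemma iter_period_at (n : nat) (pi : nat -> nat) (i : nat) :
  is_cyclic_pattern n pi -> (i < n)%nat -> Nat.iter n pi i = i.
Proof.
  intros Hc Hi. destruct (orbit_surj n pi i Hc Hi) as [k [_ <-]].
  rewrite <- Nat.iter_add, Nat.add_comm, Nat.iter_add, iter_period by (lia || exact Hc).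
  reflexivity.
Qed.

Lemma travel (n : nat) (pi : nat -> nat) (i j : nat) :
  is_cyclic_pattern n pi -> (i < n)%nat -> (j < n)%nat -> i <> j ->
  exists k, (0 < k < n)%nat /\ Nat.iter k pi i = j.
Proof.
  intros Hc Hi Hj Hij.
  destruct (orbit_surj n pi i Hc Hi) as [p [Hp Ep]].
  destruct (orbit_surj n pi j Hc Hj) as [q [Hq Eq]].
  destruct (Nat.lt_trichotomy p q) as [H|[H|H]].
  - exists (q - p)%nat. split; [lia|]. rewrite <- Ep, <- Nat.iter_add, <- Eq. f_equal. lia.
  - congruence.
  (* Here [j] precedes [i] in the orbit of 0: [n - p] steps lead back to 0, and [q] more to [j]. *)
  - exists (q + (n - p))%nat. split; [lia|].
    rewrite <- Ep, <- Nat.iter_add. replace (q + (n - p) + p)%nat with (q + n)%nat by lia.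
    rewrite Nat.iter_add, iter_period by (lia || exact Hc). exact Eq.
Qed.

Lemma pattern_no_fixpoint (n : nat) (pi : nat -> nat) (i : nat) :
  (2 <= n)%nat -> is_cyclic_pattern n pi -> (i < n)%nat -> pi i <> i.
Proof.
  intros Hn Hc Hi E.
  assert (Hfix : forall k, Nat.iter k pi i = i).
  { induction k as [|k IH]; [reflexivity|]. simpl. rewrite IH. exact E. }
  (* Any target other than the supposed fixed point gives the contradiction; 1 is available because
     [n] is at least 2. *)
  destruct (travel n pi i (if Nat.eq_dec i 0 then 1 else 0)%nat Hc Hi) as [k [_ Ek]];
    destruct (Nat.eq_dec i 0); try lia; rewrite Hfix in Ek; lia.
Qed.

Lemma nsum_orbit (n : nat) (pi g : nat -> nat) :
  (1 <= n)%nat -> is_cyclic_pattern n pi ->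
  nsum n (fun j => g (Nat.iter j pi 0%nat)) = nsum n g.
Proof.
  intros Hn Hc. apply (nsum_reindex n (fun j => Nat.iter j pi 0%nat)).
  - intros j _. apply iter_pattern_lt; [exact Hc|lia].
  - intros i Hi. apply orbit_surj; assumption.
Qed.

(* The mean of [g] over the cycle is subtracted from [g], so the increments cancel around the cycle. *)
Lemma potential_exists (n : nat) (pi g : nat -> nat) :
  (1 <= n)%nat -> is_cyclic_pattern n pi ->
  exists M : nat -> Z, forall i, (i < n)%nat ->
    M (pi i) = (M i + Z.of_nat n * Z.of_nat (g i) - Z.of_nat (nsum n g))%Z.
Proof.
  intros Hn Hc.
  set (e := fun k => Nat.iter k pi 0%nat).
  set (W := fun k => (Z.of_nat n * Z.of_nat (nsum k (fun j => g (e j))) -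
                      Z.of_nat (nsum n g) * Z.of_nat k)%Z).
  (* [idx] inverts the parametrization of the cycle by the iterates of 0; its default 0 is never
     reached, by [Hidx]. *)
  set (idx := fun i => match find (fun k => e k =? i)%nat (seq 0 n) with Some k => k | None => 0%nat end).
  assert (Hidx : forall i, (i < n)%nat -> (idx i < n)%nat /\ e (idx i) = i).
  { intros i Hi. unfold idx. destruct (find _ _) as [k|] eqn:Ef.
    - apply find_some in Ef. destruct Ef as [Hk Ek]. apply in_seq in Hk.
      apply Nat.eqb_eq in Ek. split; [lia|exact Ek].
    - exfalso. destruct (orbit_surj n pi i Hc Hi) as [k [Hk Ek]].
      apply find_none with (x := k) in Ef; [|apply in_seq; lia].
      apply Nat.eqb_neq in Ef. apply Ef. exact Ek. }
  exists (fun i => W (idx i)). intros i Hi.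
  assert (Hstep : W (S (idx i)) = (W (idx i) + Z.of_nat n * Z.of_nat (g i) - Z.of_nat (nsum n g))%Z).
  { unfold W. rewrite nsum_S. destruct (Hidx i Hi) as [_ ->]. lia. }
  rewrite <- Hstep. destruct (Hidx i Hi) as [Hlt Ei].
  assert (Hpi : (pi i < n)%nat) by (apply Hc; exact Hi).
  destruct (Hidx (pi i) Hpi) as [Hlt' Ei'].
  assert (Ee : e (idx (pi i)) = e (S (idx i))).
  { rewrite Ei'. unfold e. simpl. fold (e (idx i)). rewrite Ei. reflexivity. }
  destruct (Nat.eq_dec (S (idx i)) n) as [En|En].
  (* At the last index the orbit closes up, and the potential is consistent because [W n] is 0, as
     is [W 0]. *)
  - assert (E0 : idx (pi i) = 0%nat).
    { destruct (Nat.eq_dec (idx (pi i)) 0) as [|Hne]; [assumption|exfalso].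
      assert (Hge := cyclic_return_ge n pi (idx (pi i)) Hc).
      rewrite En in Ee. unfold e in Ee at 2. rewrite iter_period in Ee by (lia || exact Hc).
      destruct Hge as [Hge _]; [lia|exact Ee|lia]. }
    rewrite E0, En. unfold W, e. rewrite (nsum_orbit n pi g) by assumption.
    unfold nsum at 1. simpl. lia.
  - replace (idx (pi i)) with (S (idx i)); [reflexivity|].
    destruct (Nat.lt_trichotomy (S (idx i)) (idx (pi i))) as [H|[H|H]]; [|exact H|]; exfalso.
    + destruct (cyclic_return_ge n pi (idx (pi i) - S (idx i))%nat Hc) as [Hge _]; [lia| |lia].
      symmetry. apply (iter_pattern_inj n pi (S (idx i))); [exact Hc|lia|apply iter_pattern_lt; [exact Hc|lia]|].
      rewrite <- Nat.iter_add.
      replace (S (idx i) + (idx (pi i) - S (idx i)))%nat with (idx (pi i)) by lia.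
      symmetry. exact Ee.
    + destruct (cyclic_return_ge n pi (S (idx i) - idx (pi i))%nat Hc) as [Hge _]; [lia| |lia].
      symmetry. apply (iter_pattern_inj n pi (idx (pi i))); [exact Hc|lia|apply iter_pattern_lt; [exact Hc|lia]|].
      rewrite <- Nat.iter_add.
      replace (idx (pi i) + (S (idx i) - idx (pi i)))%nat with (S (idx i)) by lia.
      exact Ee.
Qed.

Lemma potential_travel (n : nat) (pi g : nat -> nat) (M : nat -> Z) (i k : nat) :
  is_cyclic_pattern n pi ->
  (forall i, (i < n)%nat ->
    M (pi i) = (M i + Z.of_nat n * Z.of_nat (g i) - Z.of_nat (nsum n g))%Z) ->
  (i < n)%nat ->
  M (Nat.iter k pi i) = (M i + Z.of_nat n * Z.of_nat (nsum k (fun j => g (Nat.iter j pi i)))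
                         - Z.of_nat (nsum n g) * Z.of_nat k)%Z.
Proof.
  intros Hc HM Hi. induction k as [|k IH].
  - unfold nsum at 1. simpl. lia.
  - rewrite nsum_S. simpl Nat.iter. rewrite HM by (apply iter_pattern_lt; assumption).
    rewrite IH. lia.
Qed.

(** * The P-linear map *)

Lemma continuity_ext (f g : R -> R) :
  (forall t, f t = g t) -> continuity f -> continuity g.
Proof.
  intros E Hf t eps Heps. destruct (Hf t eps Heps) as [d [Hd H]].
  exists d. split; [exact Hd|]. intros u Hu. rewrite <- !E. exact (H u Hu).
Qed.

Lemma continuity_Rmax (f g : R -> R) :
  continuity f -> continuity g -> continuity (fun t => Rmax (f t) (g t)).
Proof.
  intros Hf Hg.
  apply continuity_ext with (f := fun t => / 2 * ((f t + g t) + Rabs (f t - g t))).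
  - intros t. unfold Rmax. destruct (Rle_dec (f t) (g t)).
    + rewrite Rabs_left1 by lra. lra.
    + rewrite Rabs_right by lra. lra.
  - apply (continuity_scal (fun t => (f t + g t) + Rabs (f t - g t)) (/ 2)).
    apply (continuity_plus (fun t => f t + g t) (fun t => Rabs (f t - g t))).
    + apply (continuity_plus f g Hf Hg).
    + apply (continuity_comp (fun t => f t - g t) Rabs).
      * apply (continuity_minus f g Hf Hg).
      * exact Rcontinuity_abs.
Qed.

Lemma continuity_Rmin (f g : R -> R) :
  continuity f -> continuity g -> continuity (fun t => Rmin (f t) (g t)).
Proof.
  intros Hf Hg.
  apply continuity_ext with (f := fun t => - Rmax (- f t) (- g t)).
  - intros t. unfold Rmax, Rmin.
    destruct (Rle_dec (f t) (g t)), (Rle_dec (- f t) (- g t)); lra.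
  - apply (continuity_opp (fun t => Rmax (- f t) (- g t))).
    apply continuity_Rmax; [exact (continuity_opp f Hf)|exact (continuity_opp g Hg)].
Qed.

Lemma continuity_id : continuity (fun t => t).
Proof. apply derivable_continuous, derivable_id. Qed.

Lemma continuity_cst (c : R) : continuity (fun _ => c).
Proof. apply continuity_const. intros x y. reflexivity. Qed.

Lemma continuity_clamp (lo hi : R) : continuity (clamp lo hi).
Proof.
  apply (continuity_Rmax (fun _ => lo) (fun t => Rmin hi t)); [apply continuity_cst|].
  apply (continuity_Rmin (fun _ => hi) (fun t => t)); [apply continuity_cst|apply continuity_id].
Qed.

Lemma clamp_id (lo hi t : R) : lo <= t <= hi -> clamp lo hi t = t.
Proof. intros H. unfold clamp. rewrite Rmin_right, Rmax_right; lra. Qed.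

Lemma clamp_bounds (lo hi t : R) : lo <= hi -> lo <= clamp lo hi t <= hi.
Proof.
  intros H. unfold clamp, Rmax, Rmin.
  destruct (Rle_dec hi t); destruct (Rle_dec _ _); lra.
Qed.

Lemma clamp_high (lo hi t : R) : lo <= hi -> hi <= t -> clamp lo hi t = hi.
Proof. intros H H'. unfold clamp. rewrite Rmin_left, Rmax_right; lra. Qed.

Lemma clamp_low (lo hi t : R) : t <= lo -> lo <= hi -> clamp lo hi t = lo.
Proof. intros H H'. unfold clamp. rewrite Rmin_right, Rmax_left; lra. Qed.

Lemma nat_floor (N : nat) (t : R) :
  0 <= t < INR N -> exists j, (j < N)%nat /\ INR j <= t < INR (S j).
Proof.
  induction N as [|N IH]; intros H; [simpl in H; lra|].
  destruct (Rlt_dec t (INR N)).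
  - destruct IH as [j [Hj Hj']]; [lra|]. exists j. split; [lia|exact Hj'].
  - exists N. split; [lia|lra].
Qed.

Lemma nat_ceil (N : nat) (t : R) :
  0 < t <= INR N -> exists j, (j < N)%nat /\ INR j < t <= INR (S j).
Proof.
  induction N as [|N IH]; intros H; [simpl in H; lra|].
  destruct (Rle_dec t (INR N)).
  - destruct IH as [j [Hj Hj']]; [lra|]. exists j. split; [lia|exact Hj'].
  - exists N. split; [lia|lra].
Qed.

Lemma INR_pred (n : nat) : (1 <= n)%nat -> INR n - 1 = INR (n - 1).
Proof. intros H. rewrite minus_INR by lia. reflexivity. Qed.

Lemma INR_lt_pred (n i : nat) : (i < n)%nat -> 0 <= INR i <= INR n - 1.
Proof.
  intros H. rewrite INR_pred by lia. split; [apply pos_INR|apply le_INR; lia].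
Qed.

Lemma unit_interval (n : nat) (t : R) :
  (2 <= n)%nat -> 0 <= t <= INR n - 1 -> exists j, (S j < n)%nat /\ INR j <= t <= INR (S j).
Proof.
  intros Hn H. rewrite INR_pred in H by lia.
  destruct (Rle_lt_dec (INR (n - 1)) t).
  - exists (n - 2)%nat. split; [lia|]. replace (S (n - 2)) with (n - 1)%nat by lia.
    split; [|lra]. apply Rle_trans with (INR (n - 1)); [apply le_INR; lia|lra].
  - destruct (nat_floor (n - 1) t) as [j [Hj Hj']]; [lra|].
    exists j. split; [lia|lra].
Qed.

Lemma Int_part_eq (t : R) (i : nat) : INR i <= t < INR (S i) -> Z.to_nat (Int_part t) = i.
Proof.
  intros H. rewrite S_INR in H.
  rewrite <- (Int_part_spec t (Z.of_nat i)); [apply Nat2Z.id|].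
  rewrite <- INR_IZR_INZ. lra.
Qed.

Lemma plin_INR (n : nat) (pi : nat -> nat) (i : nat) :
  (i < n)%nat -> plin n pi (INR i) = INR (pi i).
Proof.
  intros Hi. unfold plin. rewrite clamp_id by (apply INR_lt_pred, Hi).
  rewrite (Int_part_eq _ i) by (rewrite S_INR; lra). lra.
Qed.

Lemma plin_affine (n : nat) (pi : nat -> nat) (j : nat) (t : R) :
  (S j < n)%nat -> INR j <= t <= INR (S j) ->
  plin n pi t = INR (pi j) + (t - INR j) * (INR (pi (S j)) - INR (pi j)).
Proof.
  (* At the right end the integer part is [S j] and no longer [j], but the two affine formulas agree
     there. *)
  intros Hj Ht. destruct (Req_dec t (INR (S j))) as [->|Hne].
  - rewrite plin_INR by exact Hj. rewrite S_INR. lra.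
  - unfold plin.
    assert (H1 := INR_lt_pred n j ltac:(lia)). assert (H2 := INR_lt_pred n (S j) Hj).
    rewrite clamp_id by lra. rewrite (Int_part_eq _ j) by lra. reflexivity.
Qed.

(* Writes the P-linear map as a sum of continuous ramps, one per gap of the cycle. *)
Fixpoint ramp_sum (pi : nat -> nat) (N : nat) (t : R) : R :=
  match N with
  | O => INR (pi 0%nat)
  | S k => ramp_sum pi k t + clamp 0 1 (t - INR k) * (INR (pi (S k)) - INR (pi k))
  end.

Lemma ramp_sum_continuity (pi : nat -> nat) (N : nat) : continuity (ramp_sum pi N).
Proof.
  induction N as [|k IH]; [exact (continuity_cst _)|].
  apply (continuity_plus (ramp_sum pi k)
    (fun t => clamp 0 1 (t - INR k) * (INR (pi (S k)) - INR (pi k)))); [exact IH|].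
  apply (continuity_mult (fun t => clamp 0 1 (t - INR k)) (fun _ => INR (pi (S k)) - INR (pi k)));
    [|apply continuity_cst].
  apply (continuity_comp (fun t => t - INR k) (clamp 0 1)); [|apply continuity_clamp].
  apply (continuity_minus (fun t => t) (fun _ => INR k)); [apply continuity_id|apply continuity_cst].
Qed.

Lemma ramp_sum_above (pi : nat -> nat) (N : nat) (t : R) :
  INR N <= t -> ramp_sum pi N t = INR (pi N).
Proof.
  induction N as [|k IH]; intros H; [reflexivity|].
  rewrite S_INR in H. simpl ramp_sum. rewrite IH by lra. rewrite clamp_high by lra. lra.
Qed.

Lemma ramp_sum_affine (pi : nat -> nat) (N j : nat) (t : R) :
  (j < N)%nat -> INR j <= t <= INR (S j) ->
  ramp_sum pi N t = INR (pi j) + (t - INR j) * (INR (pi (S j)) - INR (pi j)).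
Proof.
  induction N as [|k IH]; intros Hj Ht; [lia|]. simpl ramp_sum.
  destruct (Nat.eq_dec j k) as [->|Hne].
  - rewrite ramp_sum_above by lra. rewrite S_INR in Ht. rewrite clamp_id by lra. reflexivity.
  - rewrite IH by (lia || exact Ht).
    assert (INR (S j) <= INR k) by (apply le_INR; lia).
    rewrite clamp_low by lra. lra.
Qed.

Lemma plin_continuity (n : nat) (pi : nat -> nat) : (2 <= n)%nat -> continuity (plin n pi).
Proof.
  intros Hn.
  assert (Hp : 0 <= INR n - 1) by (apply (INR_lt_pred n 0); lia).
  apply continuity_ext with (f := fun t => ramp_sum pi (n - 1) (clamp 0 (INR n - 1) t)).
  - intros t. assert (Hb := clamp_bounds 0 (INR n - 1) t Hp).
    replace (plin n pi t) with (plin n pi (clamp 0 (INR n - 1) t))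
      by (unfold plin; rewrite (clamp_id _ _ (clamp _ _ _)) by exact Hb; reflexivity).
    destruct (unit_interval n _ Hn Hb) as [j [Hj Hj']].
    rewrite (ramp_sum_affine _ _ j) by (lia || exact Hj').
    rewrite (plin_affine _ _ j) by assumption. reflexivity.
  - apply (continuity_comp (clamp 0 (INR n - 1)) (ramp_sum pi (n - 1)));
      [apply continuity_clamp|apply ramp_sum_continuity].
Qed.

Lemma plin_hull (n : nat) (pi : nat -> nat) (j : nat) (t : R) :
  (S j < n)%nat -> INR j <= t <= INR (S j) ->
  Rmin (INR (pi j)) (INR (pi (S j))) <= plin n pi t <= Rmax (INR (pi j)) (INR (pi (S j))).
Proof.
  intros Hj Ht. rewrite (plin_affine n pi j) by assumption. rewrite S_INR in Ht.
  unfold Rmin, Rmax. destruct (Rle_dec _ _); nra.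
Qed.

Lemma plin_range (n : nat) (pi : nat -> nat) (t : R) :
  (2 <= n)%nat -> is_cyclic_pattern n pi -> 0 <= t <= INR n - 1 ->
  0 <= plin n pi t <= INR n - 1.
Proof.
  intros Hn Hc Ht. destruct (unit_interval n t Hn Ht) as [j [Hj Hj']].
  assert (H := plin_hull n pi j t Hj Hj').
  assert (H1 := INR_lt_pred n (pi j) ltac:(apply Hc; lia)).
  assert (H2 := INR_lt_pred n (pi (S j)) ltac:(apply Hc; lia)).
  unfold Rmin, Rmax in H. destruct (Rle_dec _ _); lra.
Qed.

(** * The fixed point in the middle gap *)

Record centre (n : nat) (pi : nat -> nat) (s : nat) (a : R) : Prop := {
  centre_size : (2 <= n)%nat;
  centre_cyclic : is_cyclic_pattern n pi;
  centre_gap : (S s < n)%nat;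
  centre_left : forall i, (i <= s)%nat -> (i < pi i)%nat;
  centre_right : forall i, (s < i < n)%nat -> (pi i < i)%nat;
  centre_mem : INR s < a < INR (S s);
  centre_fix : plin n pi a = a }.

(** Scanning from the left, let [S s] be the first point that moves left; it exists since the last
    point cannot move right. Convergence forbids a point that moves right beyond it. All later
    arguments use convergence through [centre]. *)
Lemma convergent_centre (n : nat) (pi : nat -> nat) :
  (2 <= n)%nat -> is_cyclic_pattern n pi -> convergent n pi -> exists s a, centre n pi s a.
Proof.
  intros Hn Hc Hconv.
  assert (Hs : forall k, (k < n)%nat ->
    (exists s, (s < k)%nat /\ (forall i, (i <= s)%nat -> (i < pi i)%nat) /\ (pi (S s) < S s)%nat) \/
    (forall i, (i <= k)%nat -> (i < pi i)%nat)).
  { induction k as [|k IH]; intros Hk.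
    - right. intros i Hi. replace i with 0%nat by lia.
      assert (H := pattern_no_fixpoint n pi 0 Hn Hc Hk). lia.
    - destruct IH as [[s [H1 H2]]|IH]; [lia|left; exists s; split; [lia|exact H2]|].
      assert (H := pattern_no_fixpoint n pi (S k) Hn Hc Hk).
      destruct (Nat.lt_total (pi (S k)) (S k)) as [H'|[H'|H']]; [|lia|].
      + left. exists k. split; [lia|split; [exact IH|exact H']].
      + right. intros i Hi. destruct (Nat.eq_dec i (S k)) as [->|]; [exact H'|apply IH; lia]. }
  destruct (Hs (n - 1)%nat) as [[s [Hsn [HL HR]]]|Hall]; [lia| |].
  2:{ exfalso. assert (H := Hall (n - 1)%nat (Nat.le_refl _)).
      assert (H' : (pi (n - 1) < n)%nat) by (apply Hc; lia). lia. }
  assert (HR' : forall i, (s < i < n)%nat -> (pi i < i)%nat).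
  { intros i Hi. assert (H := pattern_no_fixpoint n pi i Hn Hc ltac:(lia)).
    destruct (Nat.lt_total (pi i) i) as [H'|[H'|H']]; [exact H'|lia|exfalso].
    destruct (Nat.eq_dec i (S s)) as [->|]; [lia|].
    apply Hconv. exists (S s), i. repeat split; lia. }
  (* The offset [u] of the fixed point from [s] solves [pi s + u * (pi (S s) - pi s) = s + u]; [d]
     is the coefficient of [u] after collecting terms. *)
  set (d := 1 + INR (pi s) - INR (pi (S s))).
  assert (Hps : INR s + 1 <= INR (pi s)).
  { rewrite <- S_INR. apply le_INR. assert (H := HL s ltac:(lia)). lia. }
  assert (Hps' : INR (pi (S s)) <= INR s).
  { apply le_INR. lia. }
  assert (Hd : d > 0) by (unfold d; lra).
  set (u := (INR (pi s) - INR s) / d).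
  assert (Eu : u * d = INR (pi s) - INR s) by (unfold u; field; lra).
  assert (Hu : 0 < u < 1) by (unfold d in *; nra).
  exists s, (INR s + u). split; auto; try lia.
  - rewrite S_INR. lra.
  - rewrite (plin_affine n pi s) by (lia || (rewrite S_INR; lra)).
    unfold d in Eu. nra.
Qed.

Lemma centre_lt (n : nat) (pi : nat -> nat) (s : nat) (a : R) (i : nat) :
  centre n pi s a -> ((i <= s)%nat -> INR i < a) /\ ((s < i)%nat -> a < INR i).
Proof.
  intros C. assert (H := centre_mem _ _ _ _ C). split; intros Hi; apply le_INR in Hi; lra.
Qed.

Lemma centre_lt_iff (n : nat) (pi : nat -> nat) (s : nat) (a : R) (i : nat) :
  centre n pi s a -> (INR i < a <-> (i <= s)%nat) /\ (a < INR i <-> (s < i)%nat).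
Proof.
  intros C. destruct (centre_lt n pi s a i C) as [H1 H2].
  destruct (Nat.le_gt_cases i s) as [H|H];
    [specialize (H1 H)|specialize (H2 H)]; repeat split; intros; auto; lra || lia.
Qed.

(** The endpoints of the middle gap move past each other, so the slope there is at most -1. This
    negative slope is what throws points near [a] to the other side. *)
Lemma centre_middle (n : nat) (pi : nat -> nat) (s : nat) (a t : R) :
  centre n pi s a -> INR s <= t <= INR (S s) ->
  plin n pi t = a - (INR (pi s) - INR (pi (S s))) * (t - a) /\
  1 <= INR (pi s) - INR (pi (S s)).
Proof.
  intros C Ht. destruct C. split.
  - rewrite (plin_affine n pi s) by assumption.
    assert (E : INR (pi s) + (a - INR s) * (INR (pi (S s)) - INR (pi s)) = a).
    { rewrite <- (plin_affine n pi s) by (assumption || lra). assumption. }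
    lra.
  - assert (H1 := centre_left0 s ltac:(lia)). assert (H2 := centre_right0 (S s) ltac:(lia)).
    assert (INR (pi (S s)) + 1 <= INR (pi s)) by (rewrite <- S_INR; apply le_INR; lia). lra.
Qed.

(** On a gap whose two ends move right, an affine map interpolates two values above the diagonal;
    the middle gap is left to [centre_middle]. *)
Lemma plin_moves_right (n : nat) (pi : nat -> nat) (s : nat) (a t : R) :
  centre n pi s a -> 0 <= t < a -> t < plin n pi t.
Proof.
  intros C Ht. assert (Hm := centre_mem _ _ _ _ C).
  assert (Hg := centre_gap _ _ _ _ C).
  assert (INR (S s) <= INR n - 1) by (apply INR_lt_pred; exact Hg).
  destruct (nat_floor n t) as [j [Hj Hj']]; [lra|].
  assert (Hjs : (j <= s)%nat) by (apply (centre_lt_iff n pi s a j C); lra).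
  destruct (Nat.eq_dec j s) as [->|Hne].
  - destruct (centre_middle n pi s a t C) as [E H1]; [lra|]. nra.
  - assert (Hh := plin_affine n pi j t ltac:(lia) ltac:(lra)).
    assert (H1 := centre_left _ _ _ _ C j Hjs). assert (H2 := centre_left _ _ _ _ C (S j) ltac:(lia)).
    assert (INR (S j) <= INR (pi j)) by (apply le_INR; lia).
    assert (INR (S j) + 1 <= INR (pi (S j))) by (rewrite <- S_INR; apply le_INR; lia).
    rewrite S_INR in *. rewrite Hh. nra.
Qed.

Lemma plin_moves_left (n : nat) (pi : nat -> nat) (s : nat) (a t : R) :
  centre n pi s a -> a < t <= INR n - 1 -> plin n pi t < t.
Proof.
  intros C Ht. assert (Hm := centre_mem _ _ _ _ C). assert (Hn := centre_size _ _ _ _ C).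
  rewrite INR_pred in Ht by lia.
  assert (0 <= INR s) by apply pos_INR.
  destruct (nat_ceil (n - 1) t) as [j [Hj Hj']]; [lra|].
  assert (Hjs : (s < S j)%nat) by (apply (centre_lt_iff n pi s a (S j) C); lra).
  destruct (Nat.eq_dec j s) as [->|Hne].
  - destruct (centre_middle n pi s a t C) as [E H1]; [lra|]. nra.
  - assert (Hh := plin_affine n pi j t ltac:(lia) ltac:(lra)).
    assert (H1 := centre_right _ _ _ _ C j ltac:(lia)).
    assert (H2 := centre_right _ _ _ _ C (S j) ltac:(lia)).
    assert (INR (pi j) + 1 <= INR j) by (rewrite <- S_INR; apply le_INR; lia).
    assert (INR (pi (S j)) <= INR j) by (apply le_INR; lia).
    rewrite S_INR in *. rewrite Hh. nra.
Qed.

(** * Periodic orbits from loops *)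

Definition same_side (a u v : R) : Prop := (u < a /\ v < a) \/ (a < u /\ a < v).

(** The direction of motion is determined by the side of [a], so the displacements of [t] and of its
    image differ in sign exactly when the map carries [t] across [a]. *)
Lemma turn_cases (n : nat) (pi : nat -> nat) (s : nat) (a t : R) :
  centre n pi s a -> 0 <= t <= INR n - 1 -> t <> a -> plin n pi t <> a ->
  (same_side a t (plin n pi t) /\ turn (plin n pi) t = 0%nat) \/
  (~ same_side a t (plin n pi t) /\ turn (plin n pi) t = 1%nat).
Proof.
  intros C Ht Hta Hfa. set (f := plin n pi) in *.
  assert (Hf : 0 <= f t <= INR n - 1) by (apply plin_range; [apply C|apply C|exact Ht]).
  assert (HR : forall u, 0 <= u <= INR n - 1 -> u < a -> u < f u)
    by (intros u Hu Hua; apply (plin_moves_right n pi s a u C); lra).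
  assert (HL : forall u, 0 <= u <= INR n - 1 -> a < u -> f u < u)
    by (intros u Hu Hua; apply (plin_moves_left n pi s a u C); lra).
  assert (H1 := HR t Ht). assert (H2 := HL t Ht).
  assert (H3 := HR (f t) Hf). assert (H4 := HL (f t) Hf).
  unfold turn, same_side.
  destruct (Rlt_le_dec t a) as [H|H]; destruct (Rlt_le_dec (f t) a) as [H'|H'];
    destruct (Rlt_dec (f t) t); destruct (Rlt_dec t (f t));
    destruct (Rlt_dec (f t) (f (f t))); destruct (Rlt_dec (f (f t)) (f t));
    try lra; (left; split; [lra|reflexivity]) || (right; split; [lra|reflexivity]).
Qed.

Lemma cycle_lt_iff (m : nat) (x : nat -> R) (i j : nat) :
  (forall i j, (i < j)%nat -> (j < m)%nat -> x i < x j) ->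
  (i < m)%nat -> (j < m)%nat -> (x i < x j <-> (i < j)%nat).
Proof.
  intros Hx Hi Hj. split; intros H; [|apply Hx; assumption].
  destruct (Nat.lt_total i j) as [H'|[->|H']]; [exact H'|lra|].
  specialize (Hx j i H' Hi). lra.
Qed.

(** Turns depend only on the order of the points, which [x] preserves. This serves both for P itself
    and for the second cycle. *)
Lemma pat_turn_cycle (f : R -> R) (m : nat) (th : nat -> nat) (x : nat -> R) (i : nat) :
  (forall i j, (i < j)%nat -> (j < m)%nat -> x i < x j) ->
  (forall i, (i < m)%nat -> (th i < m)%nat) ->
  (forall i, (i < m)%nat -> f (x i) = x (th i)) ->
  (i < m)%nat -> pat_turn th i = turn f (x i).
Proof.
  intros Hx Hth Hf Hi. unfold turn. assert (Hi' := Hth i Hi). assert (Hi'' := Hth _ Hi').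
  rewrite !Hf by assumption.
  assert (H1 := cycle_lt_iff m x i (th i) Hx Hi Hi').
  assert (H2 := cycle_lt_iff m x (th i) i Hx Hi' Hi).
  assert (H3 := cycle_lt_iff m x (th (th i)) (th i) Hx Hi'' Hi').
  assert (H4 := cycle_lt_iff m x (th i) (th (th i)) Hx Hi' Hi'').
  unfold pat_turn.
  destruct (Nat.ltb_spec (th i) i); destruct (Nat.ltb_spec i (th i));
  destruct (Nat.ltb_spec (th i) (th (th i))); destruct (Nat.ltb_spec (th (th i)) (th i));
  destruct (Rlt_dec (x (th i)) (x i)); destruct (Rlt_dec (x i) (x (th i)));
  destruct (Rlt_dec (x (th i)) (x (th (th i)))); destruct (Rlt_dec (x (th (th i))) (x (th i)));
  simpl; try reflexivity; exfalso; lia || (intuition lia).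
Qed.

Lemma pat_turn_plin (n : nat) (pi : nat -> nat) (i : nat) :
  is_cyclic_pattern n pi -> (i < n)%nat -> pat_turn pi i = turn (plin n pi) (INR i).
Proof.
  intros Hc Hi. apply (pat_turn_cycle (plin n pi) n pi INR); [|apply Hc| |exact Hi].
  - intros j k H _. apply lt_INR, H.
  - intros j Hj. apply plin_INR, Hj.
Qed.

Lemma pat_turn_le_1 (pi : nat -> nat) (i : nat) : (pat_turn pi i <= 1)%nat.
Proof. unfold pat_turn. destruct (_ || _)%bool; lia. Qed.

Lemma centre_INR_neq (n : nat) (pi : nat -> nat) (s : nat) (a : R) (i : nat) :
  centre n pi s a -> INR i <> a.
Proof.
  intros C E. destruct (centre_lt n pi s a i C) as [H1 H2].
  destruct (Nat.le_gt_cases i s) as [H|H]; [specialize (H1 H)|specialize (H2 H)]; lra.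
Qed.

Lemma pat_turn_cases (n : nat) (pi : nat -> nat) (s : nat) (a : R) (i : nat) :
  centre n pi s a -> (i < n)%nat ->
  (same_side a (INR i) (INR (pi i)) /\ pat_turn pi i = 0%nat) \/
  (~ same_side a (INR i) (INR (pi i)) /\ pat_turn pi i = 1%nat).
Proof.
  intros C Hi. assert (Hc := centre_cyclic _ _ _ _ C).
  rewrite (pat_turn_plin n pi i Hc Hi), <- (plin_INR n pi i Hi).
  apply (turn_cases n pi s a); [exact C|apply INR_lt_pred, Hi|apply (centre_INR_neq n pi s), C|].
  rewrite plin_INR by exact Hi. apply (centre_INR_neq n pi s), C.
Qed.

(** The retraction of the line onto the closed half-line with end [a] that contains [e]; being
    continuous in [u], it keeps the folded iterates continuous. *)
Definition trunc (a e u : R) : R := if Rlt_dec e a then Rmin a u else Rmax a u.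

(* Follows the itinerary of [e]: a point leaving the side prescribed by [e] is absorbed by the fixed point [a]. *)
Fixpoint folded (f : R -> R) (a : R) (e : nat -> R) (j : nat) (t : R) : R :=
  match j with
  | O => t
  | S j' => trunc a (e (S j')) (f (folded f a e j' t))
  end.

Lemma trunc_fix (a e : R) : trunc a e a = a.
Proof. unfold trunc, Rmin, Rmax. destruct (Rlt_dec e a); destruct (Rle_dec a a); lra. Qed.

Lemma trunc_self (a e : R) : trunc a e e = e.
Proof. unfold trunc, Rmin, Rmax. destruct (Rlt_dec e a); destruct (Rle_dec a e); lra. Qed.

Lemma trunc_neq (a e u : R) :
  e <> a -> trunc a e u <> a -> trunc a e u = u /\ same_side a e u.
Proof.
  unfold trunc, same_side, Rmin, Rmax. intros He.
  destruct (Rlt_dec e a); destruct (Rle_dec a u); lra.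
Qed.

Lemma trunc_side (a e u : R) :
  (e < a -> trunc a e u <= a) /\ (a < e -> a <= trunc a e u).
Proof.
  unfold trunc, Rmin, Rmax. destruct (Rlt_dec e a); destruct (Rle_dec a u); lra.
Qed.

Lemma trunc_opposite (a e u : R) :
  (e < a -> a <= u) -> (a < e -> u <= a) -> e <> a -> trunc a e u = a.
Proof.
  intros H1 H2 He. unfold trunc, Rmin, Rmax.
  destruct (Rlt_dec e a); destruct (Rle_dec a u); lra.
Qed.

Lemma folded_continuity (f : R -> R) (a : R) (e : nat -> R) (j : nat) :
  continuity f -> continuity (folded f a e j).
Proof.
  intros Hf. induction j as [|j IH]; [exact continuity_id|].
  simpl. unfold trunc. destruct (Rlt_dec _ _).
  - apply (continuity_Rmin (fun _ => a)); [apply continuity_cst|].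
    apply (continuity_comp (folded f a e j) f); assumption.
  - apply (continuity_Rmax (fun _ => a)); [apply continuity_cst|].
    apply (continuity_comp (folded f a e j) f); assumption.
Qed.

Lemma folded_fix (f : R -> R) (a : R) (e : nat -> R) (j : nat) :
  f a = a -> folded f a e j a = a.
Proof.
  intros Hf. induction j as [|j IH]; [reflexivity|]. simpl. rewrite IH, Hf. apply trunc_fix.
Qed.

Lemma folded_absorbed (f : R -> R) (a : R) (e : nat -> R) (i j : nat) (t : R) :
  f a = a -> (i <= j)%nat -> folded f a e i t = a -> folded f a e j t = a.
Proof.
  intros Hf Hij E. induction Hij as [|j Hij IH]; [exact E|].
  simpl. rewrite IH, Hf. apply trunc_fix.
Qed.

Lemma folded_orbit (f : R -> R) (a : R) (e : nat -> R) (j : nat) :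
  (forall i, f (e i) = e (S i)) -> folded f a e j (e 0%nat) = e j.
Proof.
  intros He. induction j as [|j IH]; [reflexivity|]. simpl. rewrite IH, He. apply trunc_self.
Qed.

(** Since [a] is absorbing, a final value other than [a] shows that no truncation ever took effect,
    so the folded iterates are true iterates on the prescribed sides. *)
Lemma folded_follows (f : R -> R) (a : R) (e : nat -> R) (k : nat) (t : R) :
  f a = a -> (forall i, e i <> a) -> same_side a (e 0%nat) t -> folded f a e k t <> a ->
  forall j, (j <= k)%nat ->
    folded f a e j t = Nat.iter j f t /\ same_side a (e j) (Nat.iter j f t).
Proof.
  intros Hf He Ht Hk j. induction j as [|j IH]; intros Hj; [split; [reflexivity|exact Ht]|].
  destruct IH as [E _]; [lia|].
  assert (Hne : folded f a e (S j) t <> a).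
  { intros E'. apply Hk. apply folded_absorbed with (i := S j); assumption. }
  simpl in Hne |- *. rewrite E in Hne |- *. apply trunc_neq; [apply He|exact Hne].
Qed.

(* Near [a] every point crosses to the other side, so a step of [e] staying on one side sends everything near [a] to [a]. *)
Lemma folded_near_centre (n : nat) (pi : nat -> nat) (s : nat) (a : R) (e : nat -> R) (i k : nat) :
  centre n pi s a -> (forall i, e i <> a) -> (i < k)%nat -> same_side a (e i) (e (S i)) ->
  exists d, 0 < d /\ forall t, same_side a (e 0%nat) t -> Rabs (t - a) < d ->
    folded (plin n pi) a e k t = a.
Proof.
  intros C He Hik Hs. set (f := plin n pi).
  assert (Hm := centre_mem _ _ _ _ C). assert (Hfa : f a = a) by apply C.
  assert (Hcont : continuity (folded f a e i))
    by (apply folded_continuity, plin_continuity; apply C).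
  (* Within [eps] of [a] the folded iterate stays in the middle gap, where [centre_middle]
     applies. *)
  set (eps := Rmin (a - INR s) (INR (S s) - a)).
  assert (Heps : eps > 0) by (unfold eps, Rmin; destruct (Rle_dec _ _); lra).
  destruct (Hcont a eps Heps) as [d [Hd H]].
  exists d. split; [exact Hd|]. intros t Ht Htd.
  apply folded_absorbed with (i := S i); [exact Hfa|lia|].
  assert (Hta : t <> a) by (unfold same_side in Ht; lra).
  specialize (H t). simpl in H. unfold Rdist in H. rewrite folded_fix in H by exact Hfa.
  assert (Hu : Rabs (folded f a e i t - a) < eps).
  { apply H. split; [split; [exact I|lra]|exact Htd]. }
  set (u := folded f a e i t) in *.
  assert (Hside : (e i < a -> u <= a) /\ (a < e i -> a <= u)).
  { unfold u. destruct i as [|i'].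
    - simpl. unfold same_side in Ht. lra.
    - apply trunc_side. }
  assert (Hmid : INR s <= u <= INR (S s)).
  { apply Rabs_def2 in Hu. unfold eps, Rmin in Hu. destruct (Rle_dec _ _); lra. }
  destruct (centre_middle n pi s a u C Hmid) as [E H1].
  simpl. fold u. fold f in E. unfold same_side in Hs.
  apply trunc_opposite; [| |apply He]; intros Hlt; rewrite E; nra.
Qed.

(** The [k]-th folded iterate sends [e 0] at least as far from [a], but sends points close to [a] on
    that side to [a] itself. The intermediate value theorem gives a fixed point strictly on the side
    of [e 0]; as it is not absorbed, its true orbit has the itinerary of [e]. *)
Lemma loop_periodic (n : nat) (pi : nat -> nat) (s : nat) (a : R) (e : nat -> R) (i k : nat) :
  centre n pi s a -> (forall i, e i <> a) -> (forall i, plin n pi (e i) = e (S i)) ->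
  0 <= e 0%nat <= INR n - 1 ->
  (a < e 0%nat <= e k \/ e k <= e 0%nat < a) ->
  (i < k)%nat -> same_side a (e i) (e (S i)) ->
  exists z, 0 <= z <= INR n - 1 /\ Nat.iter k (plin n pi) z = z /\
    forall j, (j <= k)%nat -> same_side a (e j) (Nat.iter j (plin n pi) z).
Proof.
  intros C He Hf Hrange Hfar Hik Hs. set (f := plin n pi) in *.
  assert (Hfa : f a = a) by apply C.
  assert (Hcont : continuity (fun t => folded f a e k t - t)).
  { apply (continuity_minus (folded f a e k) (fun t => t)); [|apply continuity_id].
    apply folded_continuity, plin_continuity. apply C. }
  destruct (folded_near_centre n pi s a e i k C He Hik Hs) as [d [Hd Hnear]]. fold f in Hnear.
  assert (Ek : folded f a e k (e 0%nat) = e k) by (apply folded_orbit; exact Hf).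
  assert (Hm := centre_mem _ _ _ _ C).
  assert (Ha : 0 <= a <= INR n - 1).
  { assert (H1 := INR_lt_pred n (S s) (centre_gap _ _ _ _ C)).
    assert (H2 := pos_INR s). lra. }
  assert (Hz : exists z, 0 <= z <= INR n - 1 /\ same_side a (e 0%nat) z /\ folded f a e k z = z).
  { destruct Hfar as [Hfar|Hfar].
    (* Halving the minimum places [t0] strictly between [a] and [e 0] and within the absorbed
       neighbourhood. *)
    - set (t0 := a + Rmin d (e 0%nat - a) / 2).
      assert (Ht0 : a < t0 < e 0%nat /\ t0 - a < d).
      { unfold t0, Rmin. destruct (Rle_dec _ _); lra. }
      assert (E0 : folded f a e k t0 = a).
      { apply Hnear; [right; lra|rewrite Rabs_right; lra]. }
      destruct (IVT_cor _ t0 (e 0%nat) Hcont) as [z [Hz Ez]]; [lra| |].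
      + cbv beta. rewrite E0, Ek. nra.
      + cbv beta in Ez. exists z. split; [lra|split; [right; lra|lra]].
    - set (t0 := a - Rmin d (a - e 0%nat) / 2).
      assert (Ht0 : e 0%nat < t0 < a /\ a - t0 < d).
      { unfold t0, Rmin. destruct (Rle_dec _ _); lra. }
      assert (E0 : folded f a e k t0 = a).
      { apply Hnear; [left; lra|rewrite Rabs_left; lra]. }
      destruct (IVT_cor _ (e 0%nat) t0 Hcont) as [z [Hz Ez]]; [lra| |].
      + cbv beta. rewrite E0, Ek. nra.
      + cbv beta in Ez. exists z. split; [lra|split; [left; lra|lra]]. }
  destruct Hz as [z [Hz [Hzs Ez]]]. exists z. split; [exact Hz|].
  assert (Hfol : forall j, (j <= k)%nat ->
    folded f a e j z = Nat.iter j f z /\ same_side a (e j) (Nat.iter j f z)).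
  { apply folded_follows; try assumption. rewrite Ez. unfold same_side in Hzs. lra. }
  split.
  - rewrite <- (proj1 (Hfol k (Nat.le_refl k))). exact Ez.
  - intros j Hj. apply Hfol, Hj.
Qed.

(** * Crossing counts along outward loops *)

Lemma least_period_exists (f : R -> R) (z : R) (k : nat) :
  (1 <= k)%nat -> Nat.iter k f z = z ->
  exists d r, least_period f z d /\ k = (d * r)%nat.
Proof.
  intros Hk E.
  assert (Hleast : exists d, least_period f z d).
  { revert Hk E. induction k as [k IH] using lt_wf_ind. intros Hk E.
    assert (Hdec : forall b, (b <= k)%nat ->
      (exists j, (1 <= j)%nat /\ (j < b)%nat /\ Nat.iter j f z = z) \/
      (forall j, (1 <= j)%nat -> (j < b)%nat -> Nat.iter j f z <> z)).
    { induction b as [|b IHb]; intros Hb; [right; lia|].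
      destruct IHb as [[j [H1 [H2 H3]]]|Hno]; [lia|left; exists j; repeat split; auto; lia|].
      destruct (Req_dec (Nat.iter b f z) z) as [Eb|Eb].
      - destruct b as [|b]; [right; lia|]. left. exists (S b). repeat split; auto; lia.
      - right. intros j H1 H2. destruct (Nat.eq_dec j b) as [->|]; [exact Eb|apply Hno; lia]. }
    destruct (Hdec k (Nat.le_refl k)) as [[j [H1 [H2 H3]]]|Hno].
    - apply (IH j); assumption.
    - exists k. repeat split; assumption. }
  destruct Hleast as [d [Hd [Ed Hmin]]].
  exists d, (k / d)%nat. split; [repeat split; assumption|].
  assert (Hdiv := Nat.div_mod_eq k d).
  (* A nonzero remainder of [k] modulo [d] would be a return time shorter than the least period. *)
  destruct (Nat.eq_dec (k mod d) 0) as [E0|E0]; [lia|exfalso].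
  apply (Hmin (k mod d)%nat); [lia|apply Nat.mod_upper_bound; lia|].
  rewrite <- (iter_mod f z d k Ed). exact E.
Qed.

Lemma orbit_turns_mul (f : R -> R) (z : R) (d r : nat) :
  Nat.iter d f z = z -> orbit_turns f z (d * r) = (r * orbit_turns f z d)%nat.
Proof.
  intros E. change (orbit_turns f z) with (fun m => nsum m (fun k => turn f (Nat.iter k f z))).
  cbv beta. induction r as [|r IH].
  - rewrite Nat.mul_0_r. reflexivity.
  - rewrite Nat.mul_succ_r, nsum_add, IH. simpl. rewrite Nat.add_comm. f_equal.
    apply nsum_ext. intros j _. rewrite Nat.add_comm, Nat.iter_add, iter_mul_period by exact E.
    reflexivity.
Qed.

Lemma INR_div_le (T n O d : nat) :
  (1 <= n)%nat -> (1 <= d)%nat -> INR T / (2 * INR n) <= INR O / (2 * INR d) ->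
  (T * d <= n * O)%nat.
Proof.
  intros Hn Hd H. apply INR_le. rewrite !mult_INR.
  assert (1 <= INR n) by (apply (le_INR 1); lia).
  assert (1 <= INR d) by (apply (le_INR 1); lia).
  apply Rmult_le_compat_r with (r := 2 * INR n * INR d) in H; [|nra].
  replace (INR T / (2 * INR n) * (2 * INR n * INR d)) with (INR T * INR d) in H by (field; lra).
  replace (INR O / (2 * INR d) * (2 * INR n * INR d)) with (INR n * INR O) in H by (field; lra).
  exact H.
Qed.

(** A stretch of P that ends no closer to [a] than it began, on the same side, is shadowed by a
    periodic orbit with as many crossings; its over-rotation number is at least that of P. *)
Lemma loop_bound (n : nat) (pi : nat -> nat) (s : nat) (a : R) (y k : nat) :
  centre n pi s a -> r_pattern n pi (pat_rho n pi) -> (y < n)%nat ->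
  (a < INR y <= INR (Nat.iter k pi y) \/ INR (Nat.iter k pi y) <= INR y < a) ->
  (pat_turns n pi * k <= n * nsum k (fun j => pat_turn pi (Nat.iter j pi y)))%nat.
Proof.
  intros C [Hglb _] Hy Hfar.
  assert (Hc := centre_cyclic _ _ _ _ C). assert (Hn := centre_size _ _ _ _ C).
  set (c := nsum k (fun j => pat_turn pi (Nat.iter j pi y))).
  (* If every step crosses, the bound reduces to the fact that P has at most [n] turns. Otherwise
     some step stays on one side, as [loop_periodic] requires. *)
  destruct (Nat.le_gt_cases k c) as [Hck|Hck].
  { assert (HT : (pat_turns n pi <= n)%nat)
      by (apply (nsum_le_length n (pat_turn pi)); intros; apply pat_turn_le_1).
    nia. }
  destruct (nsum_lt_length k _ (fun j _ => pat_turn_le_1 pi (Nat.iter j pi y)) Hck)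
    as [i [Hik Hi0]].
  set (e := fun j => INR (Nat.iter j pi y)).
  assert (Hlt : forall j, (Nat.iter j pi y < n)%nat)
    by (intros j; apply iter_pattern_lt; assumption).
  assert (He : forall j, e j <> a) by (intros j; apply (centre_INR_neq n pi s a _ C)).
  assert (Hf : forall j, plin n pi (e j) = e (S j))
    by (intros j; unfold e; rewrite plin_INR by apply Hlt; reflexivity).
  assert (Her : forall j, 0 <= e j <= INR n - 1) by (intros j; apply INR_lt_pred, Hlt).
  assert (Hcase : forall j, (same_side a (e j) (e (S j)) /\ pat_turn pi (Nat.iter j pi y) = 0%nat) \/
    (~ same_side a (e j) (e (S j)) /\ pat_turn pi (Nat.iter j pi y) = 1%nat))
    by (intros j; apply (pat_turn_cases n pi s a _ C), Hlt).
  assert (Hsame : same_side a (e i) (e (S i))).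
  { destruct (Hcase i) as [[H _]|[_ H]]; [exact H|lia]. }
  destruct (loop_periodic n pi s a e i k C He Hf (Her 0%nat) Hfar Hik Hsame)
    as [z [Hz [Ez Hside]]].
  assert (Hrange : forall j, 0 <= Nat.iter j (plin n pi) z <= INR n - 1).
  { induction j as [|j IH]; [exact Hz|]. simpl. apply plin_range; assumption. }
  assert (Hc' : orbit_turns (plin n pi) z k = c).
  { change (orbit_turns (plin n pi) z k)
      with (nsum k (fun j => turn (plin n pi) (Nat.iter j (plin n pi) z))).
    apply nsum_ext. intros j Hj.
    assert (S1 := Hside j ltac:(lia)). assert (S2 := Hside (S j) ltac:(lia)). simpl in S2.
    destruct (turn_cases n pi s a (Nat.iter j (plin n pi) z) C (Hrange j)) as [[H E]|[H E]];
      [unfold same_side in S1; lra|unfold same_side in S2; lra| |];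
      destruct (Hcase j) as [[H' E']|[H' E']]; try congruence; exfalso;
      unfold same_side in *; lra. }
  destruct (least_period_exists (plin n pi) z k) as [d [r [Hd Ek]]]; [lia|exact Ez|].
  (* Over-rotation numbers are taken over non-fixed orbits; [z] is not fixed, since points off [a]
     move. *)
  assert (Hd2 : (2 <= d)%nat).
  { destruct Hd as [Hd1 [Ed _]].
    destruct (Nat.eq_dec d 1) as [->|]; [exfalso|lia]. simpl in Ed.
    assert (S0 := Hside 0%nat ltac:(lia)). simpl in S0.
    destruct (Rlt_le_dec z a) as [H|H].
    - assert (H' := plin_moves_right n pi s a z C ltac:(lra)). lra.
    - assert (H' := plin_moves_left n pi s a z C). unfold same_side in S0. lra. }
  assert (Hle : pat_rho n pi <= INR (orbit_turns (plin n pi) z d) / (2 * INR d)).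
  { apply Hglb. exists z, d. repeat split; try assumption; try lra; apply Hd. }
  apply INR_div_le in Hle; [|lia|lia].
  (* Going from the least period [d] to [k] multiplies length and number of turns by the same
     factor. *)
  rewrite <- Hc', Ek, orbit_turns_mul by apply Hd. nia.
Qed.

(** * Potential and semiconjugacy *)

(** By [pat_turn_cases] each turn switches the side of [a] and every other step keeps it. *)
Lemma turns_parity (n : nat) (pi : nat -> nat) (s : nat) (a : R) (y k : nat) :
  centre n pi s a -> (y < n)%nat ->
  let c := nsum k (fun j => pat_turn pi (Nat.iter j pi y)) in
  (same_side a (INR y) (INR (Nat.iter k pi y)) -> Nat.Even c) /\
  (~ same_side a (INR y) (INR (Nat.iter k pi y)) -> Nat.Odd c).
Proof.
  intros C Hy. assert (Hc := centre_cyclic _ _ _ _ C).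
  assert (H0 := centre_INR_neq n pi s a y C).
  induction k as [|k IH]; cbv zeta in *.
  - split; intros H; [exists 0%nat; reflexivity|].
    exfalso. apply H. simpl. unfold same_side. lra.
  - rewrite nsum_S. simpl Nat.iter.
    assert (Hk := iter_pattern_lt n pi k y Hc Hy).
    assert (Hk0 := centre_INR_neq n pi s a (Nat.iter k pi y) C).
    assert (Hk1 := centre_INR_neq n pi s a (pi (Nat.iter k pi y)) C).
    set (c := nsum k _) in *. destruct IH as [IHe IHo].
    destruct (pat_turn_cases n pi s a _ C Hk) as [[Hs ->]|[Hs ->]]; split; intros H.
    + rewrite Nat.add_0_r. apply IHe. unfold same_side in *. lra.
    + rewrite Nat.add_0_r. apply IHo. unfold same_side in *. lra.
    + destruct IHo as [c' Ec]; [unfold same_side in *; lra|]. exists (S c'). lia.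
    + destruct IHe as [c' Ec]; [unfold same_side in *; lra|]. exists c'. lia.
Qed.

Lemma pat_turns_even (n : nat) (pi : nat -> nat) (s : nat) (a : R) :
  centre n pi s a -> Nat.Even (pat_turns n pi).
Proof.
  intros C. assert (Hn := centre_size _ _ _ _ C). assert (Hc := centre_cyclic _ _ _ _ C).
  change (pat_turns n pi) with (nsum n (pat_turn pi)).
  rewrite <- (nsum_orbit n pi (pat_turn pi)) by (lia || exact Hc).
  apply (turns_parity n pi s a 0 n C); [lia|].
  rewrite iter_period by (lia || exact Hc).
  assert (H := centre_lt n pi s a 0 C). left. split; apply H; lia.
Qed.

(* By [loop_bound] the potential is weakly monotone; by coprimality, equality would need a full turn around the cycle. *)
Lemma potential_increasing (n : nat) (pi : nat -> nat) (s : nat) (a : R) (M : nat -> Z) (x y : nat) :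
  centre n pi s a -> r_pattern n pi (pat_rho n pi) ->
  Nat.gcd (fst (orp n pi)) (snd (orp n pi)) = 1%nat ->
  (forall i, (i < n)%nat ->
    M (pi i) = (M i + Z.of_nat n * Z.of_nat (pat_turn pi i) - Z.of_nat (pat_turns n pi))%Z) ->
  (x < n)%nat -> (y < n)%nat ->
  (a < INR y < INR x \/ INR x < INR y < a) -> (M y < M x)%Z.
Proof.
  intros C Hr Hg HM Hx Hy Hfar. assert (Hc := centre_cyclic _ _ _ _ C).
  destruct (travel n pi y x Hc Hy Hx) as [k [Hk Ek]].
  { intros ->. lra. }
  assert (Hb := loop_bound n pi s a y k C Hr Hy). rewrite Ek in Hb.
  specialize (Hb ltac:(lra)).
  assert (Hp := potential_travel n pi (pat_turn pi) M y k Hc HM Hy). rewrite Ek in Hp.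
  change (nsum n (pat_turn pi)) with (pat_turns n pi) in Hp.
  (* Both turn counts are even, so the bound can be halved to [p * k <= n * c], with [p] coprime to
     [n]. *)
  destruct (turns_parity n pi s a y k C Hy) as [He _]. rewrite Ek in He.
  destruct He as [c Hc']; [unfold same_side; lra|]. rewrite Hc' in Hb, Hp.
  destruct (pat_turns_even n pi s a C) as [p HT]. rewrite HT in Hb, Hp.
  unfold orp in Hg. cbn [fst snd] in Hg. rewrite HT, Nat.mul_comm, Nat.div_mul in Hg by lia.
  (* Equality would make [n] divide [p * k], hence [k], which lies strictly between 0 and [n]. *)
  assert (Hne : (p * k <> n * c)%nat).
  { intros E. assert (Hd : Nat.divide n k).
    { apply (Nat.gauss n p k); [exists c; lia|rewrite Nat.gcd_comm; exact Hg]. }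
    apply Nat.divide_pos_le in Hd; lia. }
  assert (p * k < n * c)%nat by lia. nia.
Qed.

(** * Rounding outward to the cycle *)

Definition weakly_inside (a u v : R) : Prop := (a < u /\ u <= v) \/ (v <= u /\ u < a).

(* [x] is the first point of the cycle met when moving from [z] away from [a]. *)
Definition outer (a z : R) (x : nat) : Prop :=
  (z < a /\ INR x <= z < INR (S x)) \/ (a < z /\ INR x - 1 < z <= INR x).

Lemma outer_exists (n : nat) (a z : R) :
  (1 <= n)%nat -> 0 <= a -> 0 <= z <= INR n - 1 -> z <> a -> exists x, (x < n)%nat /\ outer a z x.
Proof.
  intros Hn Ha Hz Hza. destruct (Rlt_le_dec z a) as [H|H].
  - destruct (nat_floor n z) as [j [Hj Hj']]; [lra|]. exists j. split; [exact Hj|left; lra].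
  - rewrite INR_pred in Hz by exact Hn.
    destruct (nat_ceil (n - 1) z) as [j [Hj Hj']]; [lra|].
    exists (S j). split; [lia|right]. rewrite S_INR in *. lra.
Qed.

(** Points of the cycle are integers, so one that lies at or beyond [z] lies at or beyond the
    outward rounding of [z]. *)
Lemma outer_least (a z : R) (x i : nat) :
  outer a z x -> weakly_inside a z (INR i) -> weakly_inside a (INR x) (INR i).
Proof.
  unfold outer, weakly_inside. rewrite S_INR.
  intros [[H H']|[H H']] [Hi|Hi]; try lra; [right|left].
  - split; [|lra]. apply le_INR. assert (Hlt : INR i < INR (S x)) by (rewrite S_INR; lra).
    apply INR_lt in Hlt. lia.
  - split; [lra|]. apply le_INR. assert (Hlt : INR x < INR (S i)) by (rewrite S_INR; lra).
    apply INR_lt in Hlt. lia.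
Qed.

Lemma outer_mono (a z z' : R) (x x' : nat) :
  outer a z x -> outer a z' x' -> z < z' -> (x <= x')%nat.
Proof.
  unfold outer. rewrite !S_INR. intros H H' Hz.
  assert (Hlt : INR x < INR (S x')) by (rewrite S_INR; lra).
  apply INR_lt in Hlt. lia.
Qed.

(** The point [z] lies between [x] and its inner neighbour, so its image lies between theirs and one
    of the two images is at least as far out on the same side. If that is the image of the inner
    neighbour, the potential has dropped strictly. *)
Lemma step_dominated (n : nat) (pi : nat -> nat) (s : nat) (a z : R) (M : nat -> Z) (x : nat) :
  centre n pi s a ->
  (forall x y, (x < n)%nat -> (y < n)%nat ->
    (a < INR y < INR x \/ INR x < INR y < a) -> (M y < M x)%Z) ->
  (x < n)%nat -> outer a z x -> plin n pi z <> a ->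
  exists w, (w < n)%nat /\ same_side a z (INR w) /\
    weakly_inside a (plin n pi z) (INR (pi w)) /\ (w = x \/ (M w < M x)%Z).
Proof.
  intros C HM Hx Ho Hfa. assert (Hm := centre_mem _ _ _ _ C). assert (Hg := centre_gap _ _ _ _ C).
  unfold weakly_inside, same_side.
  destruct Ho as [[Hz Hxz]|[Hz Hxz]].
  - assert (Hxs : (x <= s)%nat) by (apply (centre_lt_iff n pi s a x C); lra).
    (* In the middle gap the inner neighbour is beyond [a]; there linearity about the fixed point
       shows that [x] itself will do. *)
    destruct (Nat.eq_dec x s) as [->|Hne].
    + exists s. destruct (centre_middle n pi s a z C) as [E H1]; [lra|].
      assert (Es : INR (pi s) = a - (INR (pi s) - INR (pi (S s))) * (INR s - a)).
      { rewrite <- plin_INR with (n := n) at 1 by lia.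
        apply (centre_middle n pi s a (INR s) C). rewrite S_INR. lra. }
      repeat split; [lia|lra| |left; reflexivity]. left. rewrite E. nra.
    + assert (Hh := plin_hull n pi x z ltac:(lia) ltac:(lra)).
      assert (Hlt : INR (S x) < a) by (apply (centre_lt_iff n pi s a (S x) C); lia).
      assert (HMx : (M (S x) < M x)%Z)
        by (apply HM; [exact Hx|lia|rewrite S_INR in *; lra]).
      assert (Hmin : exists w, (w = x \/ w = S x) /\ weakly_inside a (plin n pi z) (INR (pi w))).
      { unfold weakly_inside, Rmin, Rmax in *.
        destruct (Rle_dec (INR (pi x)) (INR (pi (S x)))); destruct (Rlt_le_dec (plin n pi z) a);
          (exists x; split; [left; reflexivity|lra]) ||
          (exists (S x); split; [right; reflexivity|lra]). }
      destruct Hmin as [w [[-> | ->] Hw]]; [exists x|exists (S x)];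
        repeat split; try lia; try assumption; lra.
  - assert (Hxs : (s < x)%nat) by (apply (centre_lt_iff n pi s a x C); lra).
    destruct (Nat.eq_dec x (S s)) as [->|Hne].
    + exists (S s). rewrite S_INR in Hxz.
      destruct (centre_middle n pi s a z C) as [E H1]; [rewrite S_INR; lra|].
      assert (Es : INR (pi (S s)) = a - (INR (pi s) - INR (pi (S s))) * (INR (S s) - a)).
      { rewrite <- plin_INR with (n := n) at 1 by lia.
        apply (centre_middle n pi s a (INR (S s)) C). rewrite S_INR. lra. }
      repeat split; [lia|lra| |left; reflexivity]. right. rewrite E. rewrite S_INR in *. nra.
    + destruct x as [|x]; [lia|]. rewrite S_INR in Hxz.
      assert (Hh := plin_hull n pi x z ltac:(lia) ltac:(rewrite S_INR; lra)).
      assert (Hlt : a < INR x) by (apply (centre_lt_iff n pi s a x C); lia).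
      assert (HMx : (M x < M (S x))%Z)
        by (apply HM; [exact Hx|lia|rewrite S_INR in *; lra]).
      assert (Hmin : exists w, (w = x \/ w = S x) /\ weakly_inside a (plin n pi z) (INR (pi w))).
      { unfold weakly_inside, Rmin, Rmax in *.
        destruct (Rle_dec (INR (pi x)) (INR (pi (S x)))); destruct (Rlt_le_dec (plin n pi z) a);
          (exists x; split; [left; reflexivity|lra]) ||
          (exists (S x); split; [right; reflexivity|lra]). }
      destruct Hmin as [w [[-> | ->] Hw]]; [exists x|exists (S x)];
        repeat split; try lia; try assumption; rewrite ?S_INR; lra.
Qed.

Definition strictly_inside (a u v : R) : Prop := (a < u /\ u < v) \/ (v < u /\ u < a).

Lemma strictly_inside_trans (a u v w : R) :
  strictly_inside a u v -> strictly_inside a v w -> strictly_inside a u w.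
Proof. unfold strictly_inside. lra. Qed.

(* The map is affine between [c] and its inner neighbour and sends [c], the outermost point, to the outermost point, so it preserves the distance order. *)
Lemma fibre_step (n : nat) (pi : nat -> nat) (s : nat) (a u v : R) (c : nat) :
  centre n pi s a -> (c < n)%nat -> outer a u c -> outer a v c -> strictly_inside a u v ->
  outer a (plin n pi u) (pi c) -> strictly_inside a (plin n pi u) (plin n pi v).
Proof.
  intros C Hc Hu Hv Huv Hfu. assert (Hg := centre_gap _ _ _ _ C).
  destruct (centre_cyclic _ _ _ _ C) as [_ [Hinj _]].
  assert (Hslope : forall i j, (i < n)%nat -> (j < n)%nat -> i <> j -> INR (pi i) <> INR (pi j)).
  { intros i j Hi Hj Hij E. apply Hij, Hinj; auto. apply INR_eq, E. }
  unfold outer in Hu, Hv, Hfu. unfold strictly_inside in *.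
  destruct Huv as [Huv|Huv].
  - assert (Hcs : (s < c)%nat) by (apply (centre_lt_iff n pi s a c C); lra).
    destruct c as [|c]; [lia|]. rewrite S_INR in Hu, Hv.
    assert (Hs := Hslope (S c) c Hc ltac:(lia) ltac:(lia)).
    assert (Eu := plin_affine n pi c u Hc ltac:(rewrite S_INR; lra)).
    assert (Ev := plin_affine n pi c v Hc ltac:(rewrite S_INR; lra)).
    set (D := INR (pi (S c)) - INR (pi c)) in *.
    assert (HD : INR (pi (S c)) = INR (pi c) + D) by (unfold D; lra).
    assert (Hd : D <> 0) by lra.
    destruct (Rlt_le_dec D 0); destruct Hfu as [Hfu|Hfu]; nra.
  - assert (Hcs : (c <= s)%nat) by (apply (centre_lt_iff n pi s a c C); lra).
    assert (Hs := Hslope (S c) c ltac:(lia) ltac:(lia) ltac:(lia)).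
    assert (Eu := plin_affine n pi c u ltac:(lia) ltac:(lra)).
    assert (Ev := plin_affine n pi c v ltac:(lia) ltac:(lra)).
    set (D := INR (pi (S c)) - INR (pi c)) in *.
    assert (Hd : D <> 0) by (unfold D; lra).
    destruct (Rlt_le_dec D 0); destruct Hfu as [Hfu|Hfu]; nra.
Qed.

Lemma finite_choice (m : nat) (P : nat -> nat -> Prop) :
  (forall i, (i < m)%nat -> exists j, P i j) -> exists g, forall i, (i < m)%nat -> P i (g i).
Proof.
  induction m as [|m IH]; intros H; [exists (fun i => i); lia|].
  destruct IH as [g Hg]; [intros i Hi; apply H; lia|].
  destruct (H m) as [j Hj]; [lia|].
  exists (fun i => if Nat.eq_dec i m then j else g i). intros i Hi.
  destruct (Nat.eq_dec i m) as [->|]; [exact Hj|apply Hg; lia].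
Qed.

(** Telescoping, with strictness inherited from any single strict step. Around a closed orbit with
    zero total this forces equality at every step. *)
Lemma descent_sum (N : nat -> Z) (c : nat -> nat) (A T : Z) (k : nat) :
  (forall j, (N (S j) <= N j + A * Z.of_nat (c j) - T)%Z) ->
  (N k <= N 0%nat + A * Z.of_nat (nsum k c) - T * Z.of_nat k)%Z /\
  ((exists j, (j < k)%nat /\ (N (S j) < N j + A * Z.of_nat (c j) - T)%Z) ->
   (N k < N 0%nat + A * Z.of_nat (nsum k c) - T * Z.of_nat k)%Z).
Proof.
  intros H. induction k as [|k [IH1 IH2]].
  - split; [unfold nsum; simpl; lia|]. intros [j [Hj _]]. lia.
  - rewrite nsum_S. specialize (H k). split; [nia|].
    intros [j [Hj Hlt]]. destruct (Nat.eq_dec j k) as [->|]; [nia|].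
    specialize (IH2 ltac:(exists j; split; [lia|exact Hlt])). nia.
Qed.

(** Counting up from 0 gives [i <= g i], counting down from [m - 1] gives an upper bound, and
    surjectivity makes the two bounds meet. *)
Lemma increasing_bijection (m n : nat) (g : nat -> nat) :
  (forall i, (i < m)%nat -> (g i < n)%nat) ->
  (forall i j, (i < j)%nat -> (j < m)%nat -> (g i < g j)%nat) ->
  (forall j, (j < n)%nat -> exists i, (i < m)%nat /\ g i = j) ->
  n = m /\ forall i, (i < m)%nat -> g i = i.
Proof.
  intros Hlt Hmono Hsurj.
  assert (Hge : forall i, (i < m)%nat -> (i <= g i)%nat).
  { induction i as [|i IH]; intros Hi; [lia|].
    specialize (IH ltac:(lia)). specialize (Hmono i (S i) ltac:(lia) Hi). lia. }
  assert (Hnm : (n <= m)%nat).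
  { assert (L : (length (seq 0 n) <= length (map g (seq 0 m)))%nat).
    { apply NoDup_incl_length; [apply seq_NoDup|]. intros j Hj. apply in_seq in Hj.
      destruct (Hsurj j ltac:(lia)) as [i [Hi <-]]. apply in_map, in_seq. lia. }
    rewrite length_map, !length_seq in L. exact L. }
  assert (Hle : forall k, (k < m)%nat -> (g (m - 1 - k) <= n - 1 - k)%nat).
  { induction k as [|k IH]; intros Hk.
    - specialize (Hlt (m - 1 - 0)%nat ltac:(lia)). lia.
    - specialize (IH ltac:(lia)).
      specialize (Hmono (m - 1 - S k)%nat (m - 1 - k)%nat ltac:(lia) ltac:(lia)). lia. }
  split.
  - destruct m as [|m]; [lia|]. specialize (Hge m ltac:(lia)). specialize (Hlt m ltac:(lia)). lia.
  - intros i Hi. specialize (Hge i Hi). specialize (Hle (m - 1 - i)%nat ltac:(lia)).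
    replace (m - 1 - (m - 1 - i))%nat with i in Hle by lia. lia.
Qed.

(* Otherwise two points of one fibre would be moved apart from [a] in the same order forever, contradicting periodicity. *)
Lemma fibre_injective (n : nat) (pi : nat -> nat) (s : nat) (a : R)
    (m : nat) (th : nat -> nat) (x : nat -> R) (g : nat -> nat) (i j : nat) :
  centre n pi s a -> is_cyclic_pattern m th ->
  (forall i, (i < m)%nat -> plin n pi (x i) = x (th i)) ->
  (forall i, (i < m)%nat -> (g i < n)%nat /\ outer a (x i) (g i)) ->
  (forall i, (i < m)%nat -> g (th i) = pi (g i)) ->
  (i < m)%nat -> (j < m)%nat -> g i = g j -> ~ strictly_inside a (x i) (x j).
Proof.
  intros C Hc Hf Hg Hgth Hi Hj Eg Hin.
  assert (Hij : i <> j) by (intros ->; unfold strictly_inside in Hin; lra).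
  destruct (travel m th i j Hc Hi Hj Hij) as [d [_ Ed]].
  assert (Hr : forall r, g (Nat.iter r th i) = g (Nat.iter r th j) /\
    strictly_inside a (x (Nat.iter r th i)) (x (Nat.iter r th j))).
  { induction r as [|r [E IH]]; [split; assumption|]. simpl.
    assert (Hir := iter_pattern_lt m th r i Hc Hi).
    assert (Hjr := iter_pattern_lt m th r j Hc Hj).
    split; [rewrite !Hgth by assumption; f_equal; exact E|].
    rewrite <- !Hf by assumption.
    apply (fibre_step n pi s a _ _ (g (Nat.iter r th i)) C); [apply Hg, Hir|apply Hg, Hir| |exact IH|].
    - rewrite E. apply Hg, Hjr.
    - rewrite Hf, <- Hgth by assumption. apply Hg. apply (iter_pattern_lt m th 1 _ Hc Hir). }
  assert (Hq : forall q, strictly_inside a (x i) (x (Nat.iter (d * S q) th i))).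
  { induction q as [|q IH]; [rewrite Nat.mul_1_r, Ed; exact Hin|].
    apply (strictly_inside_trans _ _ _ _ IH).
    replace (d * S (S q))%nat with (d * S q + d)%nat by lia.
    rewrite Nat.iter_add, Ed. apply Hr. }
  (* After [m] rounds of length [d] the orbit is back at its start, which would lie strictly inside
     itself. *)
  specialize (Hq (m - 1)%nat). replace (S (m - 1)) with m in Hq by lia.
  rewrite Nat.mul_comm, iter_mul_period in Hq by (apply iter_period_at; assumption).
  unfold strictly_inside in Hq. lra.
Qed.

Theorem theorem2p4 (n : nat) (pi : nat -> nat) :
  (2 <= n)%nat ->
  is_cyclic_pattern n pi ->
  convergent n pi ->
  r_pattern n pi (pat_rho n pi) ->
  Nat.gcd (fst (orp n pi)) (snd (orp n pi)) = 1%nat ->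
  over_twist n pi.
Proof.
  intros Hn Hc Hconv Hr Hgcd m th Hm Hcth Hrho Hforce.
  destruct (convergent_centre n pi Hn Hc Hconv) as [s [a C]].
  set (f := plin n pi).
  assert (Ha : 0 <= a) by (assert (H := centre_mem _ _ _ _ C); assert (H' := pos_INR s); lra).
  (* Forcing is applied to the P-linear map, in which [INR] exhibits P; [x] enumerates the resulting
     cycle Q of pattern [th]. *)
  destruct (Hforce f 0 (INR n - 1)) as [x [Hx [Hxr Hfx]]].
  { split; [apply (INR_lt_pred n 0); lia|]. split; [apply plin_continuity, Hn|].
    intros t Ht. apply plin_range; assumption. }
  { exists INR. split; [|split].
    - intros i j Hij _. apply lt_INR, Hij.
    - intros i Hi. apply INR_lt_pred, Hi.
    - intros i Hi. apply plin_INR, Hi. }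
  assert (Hth : forall i, (i < m)%nat -> (th i < m)%nat) by apply Hcth.
  (* A cycle through the fixed point [a] would give [th] a fixed point. *)
  assert (Hxa : forall i, (i < m)%nat -> x i <> a).
  { intros i Hi E. assert (E' : x (th i) = x i).
    { rewrite <- Hfx, E by exact Hi. apply C. }
    assert (Hne := pattern_no_fixpoint m th i Hm Hcth Hi).
    destruct (Nat.lt_total i (th i)) as [H|[H|H]]; [|congruence|].
    - specialize (Hx i (th i) H (Hth i Hi)). lra.
    - specialize (Hx (th i) i H Hi). lra. }
  destruct (finite_choice m (fun i c => (c < n)%nat /\ outer a (x i) c)) as [g Hg].
  { intros i Hi. apply outer_exists; auto. lia. }
  destruct (potential_exists n pi (pat_turn pi)) as [M HM]; [lia|exact Hc|].
  change (nsum n (pat_turn pi)) with (pat_turns n pi) in HM.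
  assert (Hinc : forall x y, (x < n)%nat -> (y < n)%nat ->
    (a < INR y < INR x \/ INR x < INR y < a) -> (M y < M x)%Z).
  { intros u v Hu Hv H. apply (potential_increasing n pi s a M u v); assumption. }
  assert (Hstep : forall i, (i < m)%nat ->
    (M (g (th i)) <= M (g i) + Z.of_nat n * Z.of_nat (pat_turn th i) - Z.of_nat (pat_turns n pi))%Z /\
    (g (th i) <> pi (g i) ->
     M (g (th i)) < M (g i) + Z.of_nat n * Z.of_nat (pat_turn th i) - Z.of_nat (pat_turns n pi))%Z).
  { intros i Hi. destruct (Hg i Hi) as [Hgi Hoi]. destruct (Hg (th i) (Hth i Hi)) as [Hgt Hot].
    assert (Hfa : f (x i) <> a) by (rewrite Hfx by exact Hi; apply Hxa, Hth, Hi).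
    destruct (step_dominated n pi s a (x i) M (g i) C Hinc Hgi Hoi Hfa)
      as [w [Hw [Hsame [Hin HMw]]]].
    assert (Hpw : (pi w < n)%nat) by (apply Hc; exact Hw).
    (* The points [x i] and [w] share a side of [a], and so do their images; hence both cross or
       neither does. *)
    assert (Et : pat_turn th i = pat_turn pi w).
    { rewrite (pat_turn_cycle f m th x i Hx Hth Hfx Hi).
      destruct (turn_cases n pi s a (x i) C (Hxr i Hi) (Hxa i Hi) Hfa) as [[H1 E1]|[H1 E1]];
        destruct (pat_turn_cases n pi s a w C Hw) as [[H2 E2]|[H2 E2]];
        unfold f; try congruence; exfalso;
        unfold same_side, weakly_inside in *; lra. }
    rewrite Et. fold f in Hin. rewrite Hfx in Hin by exact Hi.
    assert (Hout := outer_least a _ _ _ Hot Hin).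
    (* The outward rounding [g (th i)] is no farther from [a] than [pi w], and the potential grows
       outward. *)
    assert (HMg : (M (g (th i)) < M (pi w))%Z \/ g (th i) = pi w).
    { destruct (Nat.eq_dec (g (th i)) (pi w)) as [E|E]; [right; exact E|left].
      assert (INR (g (th i)) <> INR (pi w)) by (intros E'; apply E, INR_eq, E').
      apply Hinc; try assumption. unfold weakly_inside in Hout. lra. }
    specialize (HM w Hw).
    (* Equality survives only if [w] is [g i] and [g (th i)] is [pi w], that is, if [g] commutes
       with the dynamics at [i]. *)
    destruct HMg as [HMg|HMg]; destruct HMw as [-> |HMw];
      [| |rewrite HMg; split; [lia|congruence]|rewrite HMg]; split; lia. }
  assert (HT : (n * pat_turns m th = pat_turns n pi * m)%nat).
  { unfold pat_rho in Hrho. apply Nat.le_antisymm.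
    - rewrite (Nat.mul_comm n), (Nat.mul_comm _ m). apply INR_div_le; [lia|lia|lra].
    - apply INR_div_le; [lia|lia|lra]. }
  assert (Hgth : forall i, (i < m)%nat -> g (th i) = pi (g i)).
  { intros i Hi. destruct (Nat.eq_dec (g (th i)) (pi (g i))) as [E|E]; [exact E|exfalso].
    destruct (orbit_surj m th i Hcth Hi) as [k [Hk Ek]].
    set (e := fun j => Nat.iter j th 0%nat).
    assert (He : forall j, (e j < m)%nat) by (intros j; apply iter_pattern_lt; [exact Hcth|lia]).
    destruct (descent_sum (fun j => M (g (e j))) (fun j => pat_turn th (e j))
      (Z.of_nat n) (Z.of_nat (pat_turns n pi)) m) as [_ Hlt].
    { intros j. apply (Hstep (e j) (He j)). }
    assert (Ee : e m = 0%nat) by (apply iter_period; [lia|exact Hcth]).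
    cbv beta in Hlt. rewrite Ee in Hlt.
    assert (Es : nsum m (fun j => pat_turn th (e j)) = pat_turns m th)
      by (apply (nsum_orbit m th (pat_turn th)); [lia|exact Hcth]).
    rewrite Es in Hlt.
    change (e 0%nat) with 0%nat in Hlt.
    (* Around Q the increments sum to 0 by [HT], so a single strict step would push the potential
       below itself. *)
    assert (Hcontra : (M (g 0%nat) < M (g 0%nat))%Z); [|lia].
    eapply Z.lt_le_trans; [apply Hlt|nia].
    exists k. split; [exact Hk|]. change (e (S k)) with (th (Nat.iter k th 0%nat)).
    unfold e. rewrite Ek. apply Hstep; assumption. }
  assert (Hmono : forall i j, (i < j)%nat -> (j < m)%nat -> (g i < g j)%nat).
  { intros i j Hij Hj. assert (Hi : (i < m)%nat) by lia. assert (Hlt := Hx i j Hij Hj).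
    destruct (Hg i Hi) as [_ Hoi]. destruct (Hg j Hj) as [_ Hoj].
    assert (Hle := outer_mono a _ _ _ _ Hoi Hoj Hlt).
    destruct (Nat.eq_dec (g i) (g j)) as [E|]; [exfalso|lia].
    assert (Hij' := fibre_injective n pi s a m th x g i j C Hcth Hfx Hg Hgth Hi Hj E).
    assert (Hji' := fibre_injective n pi s a m th x g j i C Hcth Hfx Hg Hgth Hj Hi (eq_sym E)).
    rewrite E in Hoi. unfold outer in Hoi, Hoj.
    (* Two points of one fibre lie on one side of [a]; the farther one is [x i] on the left and
       [x j] on the right. *)
    destruct (Rlt_le_dec (x j) a); [apply Hji'; right|apply Hij'; left]; lra. }
  destruct (increasing_bijection m n g) as [Enm Hid]; [apply Hg|exact Hmono| |].
  (* Surjectivity: the image of [g] is invariant under [pi], and P is a single cycle. *)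
  { intros j Hj. assert (H0 : (0 < m)%nat) by lia.
    assert (Hiter : forall k, g (Nat.iter k th 0%nat) = Nat.iter k pi (g 0%nat)).
    { induction k as [|k IH]; [reflexivity|]. simpl.
      rewrite Hgth by (apply iter_pattern_lt; assumption). f_equal. exact IH. }
    destruct (Nat.eq_dec (g 0%nat) j) as [E|E]; [exists 0%nat; split; assumption|].
    destruct (travel n pi (g 0%nat) j Hc (proj1 (Hg _ H0)) Hj E) as [k [_ Ek]].
    exists (Nat.iter k th 0%nat). split; [apply iter_pattern_lt; assumption|].
    rewrite Hiter. exact Ek. }
  split; [exact Enm|]. intros i Hi. assert (Him : (i < m)%nat) by lia.
  (* Since [g] is the identity, the semiconjugacy [Hgth] says that [th] and [pi] agree. *)
  rewrite <- (Hid (th i)) by (apply Hth, Him). rewrite Hgth, Hid by exact Him. reflexivity.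
Qed.
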